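(* Consider the pricing model described in the context with a single server ($C=1$), and any $\Lambda>0$, $\mu>0$ and regular $F$. Let $\pi^*$ be an optimal dynamic policy and $\tilde\lambda=\sum_{i\ge0}\lambda_i^*\mathbb{P}_i(\pi^* )$ its average arrival rate. Define \[ g(\gamma)=\begin{cases}1,&\gamma=0,\\ \frac{2}{\sqrt3},&\gamma=1,\\ 1.532,&\gamma=2,\\ \frac{\gamma+1}{2},&\gamma\ge3.\end{cases} \] Then for every $\gamma\in\{0,1,2,\dots\}$ the static policy $\pi^{\tilde\lambda,\gamma}$ simultaneously satisfies \[ \mathcal{R}(\pi^{\tilde\lambda,\gamma})\ \ge\ \frac{\gamma+1}{\gamma+2}\,\mathcal{R}(\pi^* )\qquad\text{and}\qquad \mathcal{C}(\pi^{\tilde\lambda,\gamma})\ \le\ g(\gamma)\,\mathcal{C}(\pi^* ). \] Moreover, for each $\gamma$ this analysis is tight: neither the factor $\frac{\gamma+1}{\gamma+2}$ nor the factor $g(\gamma)$ can be improved in general (there are problem instances attaining them, or approaching them arbitrarily closely).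
   Context: Model: a service system with $C\ge 1$ identical parallel servers and one first-come-first-served queue of unlimited size. Potential customers arrive according to a Poisson process of rate $\Lambda>0$; each has a valuation drawn i.i.d. from a regular (in Myerson's sense) distribution $F$. A customer offered price $p$ joins iff their valuation is at least $p$, so the effective arrival rate is $\lambda(p)=\Lambda(1-F(p))$; this map is assumed to be a bijection between prices and rates, with inverse $p(\lambda)$, and $\lambda\mapsto\lambda p(\lambda)$ is concave. Service times are i.i.d. exponential with rate $\mu>0$, independent of valuations. The provider incurs a congestion cost $c>0$ per customer in the system per unit time. A policy $\pi$ is a sequence $(\lambda_0,\lambda_1,\dots)$ with $\lambda_i\in[0,\Lambda]$: with $i$ customers present the price $p(\lambda_i)$ is posted. The number in system is a birth–death process with birth rate $\lambda_i$ and death rate $\mu\min(i,C)$ in state $i$; when stable its stationary probabilities are $\mathbb{P}_i(\pi)=\prod_{k=0}^{i-1}\frac{\lambda_k}{\mu\min(k+1,C)}\big/\big(1+\sum_{n\ge0}\prod_{k=0}^{n}\frac{\lambda_k}{\mu\min(k+1,C)}\big)$. Revenue rate $\mathcal{R}(\pi)=\sum_{i}\lambda_i p(\lambda_i)\mathbb{P}_i(\pi)$; congestion cost $\mathcal{C}(\pi)=c\sum_i i\,\mathbb{P}_i(\pi)$ ($+\infty$ if unstable); objective $\mathcal{Z}(\pi)=\mathcal{R}(\pi)-\mathcal{C}(\pi)$. An optimal dynamic policy $\pi^*=(\lambda_0^*,\lambda_1^*,\dots)$ maximizes $\mathcal{Z}$ over all such policies. For a rate $\lambda$ and integer $\gamma\ge0$,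 the static (cutoff) policy $\pi^{\lambda,\gamma}$ uses arrival rate $\lambda$ in states $0,1,\dots,\gamma$ and arrival rate $0$ in all states $\ge\gamma+1$.
   Formalization: For γ=2 the literal factor 1.532 is not tight: the best constant is the maximum of (1+2r+3r²)/(1+r+r²+r³) ≈ 1.53176. The bound with 1.532 is stated; tightness at γ=2 says that a sharp constant exists within 0.0005 of 1.532. *)

(* Defs.v *)
From HB Require Import structures.
From mathcomp Require Import all_boot all_order all_algebra.
From mathcomp Require Import all_classical all_reals all_analysis.

Set Implicit Arguments.
Unset Strict Implicit.
Unset Printing Implicit Defensive.

Import Order.TTheory GRing.Theory Num.Theory.
Import numFieldNormedType.Exports.

Local Open Scope classical_set_scope.
Local Open Scope ring_scope.

Section Valuations.
Context {R : realType}.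
Implicit Types (nu : probability (measurableTypeR R) R) (I : interval R).

Definition valuation_cdf nu (x : R) : R := fine (nu `]-oo, x]%classic).

Definition virtual_value nu (f : R -> R) (x : R) : R :=
  x - (1 - valuation_cdf nu x) / f x.

(* Myerson regularity: [nu] has a density [f], positive exactly on the
   (possibly unbounded) interval [I], with nondecreasing virtual value there.
   A density is only determined up to a null set, so some version is asked
   to have these properties. *)
Definition regular nu I : Prop :=
  exists f : R -> R,
    [/\ measurable_fun [set: R] f,
        forall x, 0 <= f x,
        forall A, measurable A ->
          nu A = (\int[lebesgue_measure]_(x in A) (f x)%:E)%E,
        forall x, (0 < f x) = (x \in I)
      & {in I &, {homo virtual_value nu f : x y / x <= y}}].

Definition arrival_rate (Lam : R) nu (x : R) : R :=
  Lam * (1 - valuation_cdf nu x).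

(* Prices in the valuation range at which some customers join.  The rate 0
   corresponds to a choke price, which is infinite if valuations are
   unbounded; it is therefore left out of the price/rate bijection.  No
   revenue depends on it, since the revenue rate [l * p l] vanishes at
   [l = 0] whatever the value of [p 0]. *)
Definition admissible_prices (Lam : R) nu I : set R :=
  [set x | x \in I /\ 0 < arrival_rate Lam nu x].

End Valuations.

Record pricing_model (R : realType) := PricingModel {
  servers : nat ;
  market_rate : R ;
  service_rate : R ;
  holding_cost : R ;
  valuation : probability (measurableTypeR R) R ;
  valuation_range : interval R ;
  price : R -> R ; (* the inverse demand, rate |-> price *)
  servers_gt0 : (0 < servers)%N ;
  market_rate_gt0 : 0 < market_rate ;
  service_rate_gt0 : 0 < service_rate ;
  holding_cost_gt0 : 0 < holding_cost ;
  valuation_regular : regular valuation valuation_range ;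
  arrival_rate_bij :
    set_bij (admissible_prices market_rate valuation valuation_range)
      `]0, market_rate]%classic (arrival_rate market_rate valuation) ;
  arrival_rateK : forall x,
    admissible_prices market_rate valuation valuation_range x ->
    price (arrival_rate market_rate valuation x) = x ;
  revenue_concave : @convex_function R R^o `[0, market_rate]%classic
    (fun l : R => - (l * price l))
}.

(* [pi i] is the arrival rate set when [i] customers are present. *)
Definition policy (R : realType) : Type := nat -> R.

Section Performance.
Context {R : realType}.
Variable M : pricing_model R.
Implicit Type pi : policy R.

Definition admissible pi : Prop := forall i, 0 <= pi i <= market_rate M.

Definition weight pi (i : nat) : R :=
  \prod_(k < i) (pi k / (service_rate M * (minn k.+1 (servers M))%:R)).

Definition total_weight pi : \bar R :=
  (1 + \sum_(0 <= n <oo) (weight pi n.+1)%:E)%E.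

Definition stable pi : Prop := (total_weight pi < +oo)%E.

(* Equal to 0 if [pi] is unstable, because [fine +oo = 0]. *)
Definition stationary_prob pi (i : nat) : R :=
  weight pi i / fine (total_weight pi).

Definition revenue pi : R :=
  limn (series (fun i => pi i * price M (pi i) * stationary_prob pi i)).

Definition congestion_cost pi : \bar R :=
  if `[< stable pi >] then
    ((holding_cost M)%:E *
       \sum_(0 <= i <oo) (i%:R * stationary_prob pi i)%:E)%E
  else +oo%E.

Definition objective pi : \bar R := ((revenue pi)%:E - congestion_cost pi)%E.

Definition optimal pi : Prop :=
  admissible pi /\
  forall pi', admissible pi' -> (objective pi' <= objective pi)%E.

Definition average_rate pi : R :=
  limn (series (fun i => pi i * stationary_prob pi i)).

End Performance.

Definition static_policy (R : realType) (l : R) (gamma : nat) : policy R :=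
  fun i => if (i <= gamma)%N then l else 0.

(* At [gamma = 2] the best possible factor is the maximum over [0 <= r <= 1] of
   (1 + 2 r + 3 r^2) / (1 + r + r^2 + r^3) = 1.53176...;
   1.532 is that number rounded to three decimals. *)
Definition cost_factor (R : realType) (gamma : nat) : R :=
  match gamma with
  | 0%N => 1
  | 1%N => 2 / Num.sqrt 3
  | 2%N => 1532 / 1000
  | _ => gamma.+1%:R / 2
  end.

(* Main.v *)
Require Import Defs.
From mathcomp Require Import all_boot all_order all_algebra.
From mathcomp Require Import all_classical all_reals all_analysis.
From mathcomp Require Import ring lra.
Import Order.TTheory GRing.Theory Num.Theory.
Import numFieldNormedType.Exports.
Local Open Scope ring_scope.

(* With one server, balance [l_i P_i = mu P_{i+1}] gives the average rate
   [mu (1 - P_0)], so the static policy is the queue truncated at [gamma + 1]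
   with load [r = 1 - P_0 < 1].  Jensen's inequality for the concave revenue
   [l p(l)] bounds the optimal revenue by [l~ p(l~)], of which the static policy
   collects the fraction of arrivals that are not blocked.  For the cost,
   [sum_i i P_i >= 1 - P_0 = r] reduces the claim to bounding
   [(sum_{i <= gamma} (i+1) r^i) / (sum_{i <= gamma+1} r^i)] over [0 < r < 1],
   and the best factor is its supremum.

   Every bound is attained in the limit when the optimal policy serves at
   most one customer at a time: then [sum_i i P_i = r] exactly.  This happens
   for valuations uniform on [1, 1 + b] with [b] small, [mu = 1] and [c = 3/4],
   where the system earns about [1 - c > 0] per unit of time with one customer
   present, but [1 + b - 2 c < 0] with two. *)

(** * Geometric sums *)

Definition geom_sum {R : realFieldType} (n : nat) (r : R) : R :=
  \sum_(i < n) r ^+ i.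

Definition arith_geom_sum {R : realFieldType} (n : nat) (r : R) : R :=
  \sum_(i < n) i.+1%:R * r ^+ i.

Section GeometricSums.
Context {R : realFieldType}.
Implicit Types (n : nat) (r : R).

Lemma geom_sumS n r : geom_sum n.+1 r = geom_sum n r + r ^+ n.
Proof. by rewrite /geom_sum big_ord_recr. Qed.

Lemma arith_geom_sumS n r :
  arith_geom_sum n.+1 r = arith_geom_sum n r + n.+1%:R * r ^+ n.
Proof. by rewrite /arith_geom_sum big_ord_recr. Qed.

Lemma geom_sum0 r : geom_sum 0 r = 0.
Proof. by rewrite /geom_sum big_ord0. Qed.

Lemma arith_geom_sum0 r : arith_geom_sum 0 r = 0.
Proof. by rewrite /arith_geom_sum big_ord0. Qed.

Lemma geom_sum_ge0 n r : 0 <= r -> 0 <= geom_sum n r.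
Proof. by move=> r0; apply: sumr_ge0 => i _; rewrite exprn_ge0. Qed.

Lemma geom_sum_gt0 n r : 0 <= r -> 0 < geom_sum n.+1 r.
Proof.
by move=> r0; rewrite /geom_sum big_ord_recl expr0 ltr_wpDr// sumr_ge0// => i _;
  rewrite exprn_ge0.
Qed.

Lemma arith_geom_sum_ge0 n r : 0 <= r -> 0 <= arith_geom_sum n r.
Proof. by move=> r0; apply: sumr_ge0 => i _; rewrite mulr_ge0// exprn_ge0. Qed.

Lemma geom_sum_at1 n : geom_sum n (1 : R) = n%:R.
Proof.
by rewrite /geom_sum; under eq_bigr do rewrite expr1n; rewrite sumr_const card_ord.
Qed.

Lemma arith_geom_sum_at1 n : arith_geom_sum n (1 : R) = (n * n.+1)%:R / 2.
Proof.
elim: n => [|n IH]; first by rewrite arith_geom_sum0 mul0n mul0r.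
by rewrite arith_geom_sumS IH expr1n !natrM -(natr1 n.+1) -(natr1 n); field.
Qed.

Lemma sum_index_geom n r :
  \sum_(i < n.+1) i%:R * r ^+ i = r * arith_geom_sum n r.
Proof.
rewrite big_ord_recl mul0r add0r mulr_sumr; apply: eq_bigr => i _.
by rewrite lift0 exprS; ring.
Qed.

(** Cancelling the common part leaves [n r^n <= sum_{i<n} r^i], which holds term by term. It bounds
    from below the fraction of arrivals that a truncated queue admits. *)
Lemma acceptance_ratio n r : 0 <= r <= 1 ->
  n%:R * geom_sum n.+1 r <= n.+1%:R * geom_sum n r.
Proof.
move=> /andP[r0 r1]; rewrite geom_sumS -natr1 mulrDr mulrDl mul1r lerD2l.
rewrite -[leLHS]mulrC mulr_natr /geom_sum -[leLHS](_ : \sum_(i < n) r ^+ n = _).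
  by apply: ler_sum => i _; rewrite ler_wiXn2l// ltnW.
by rewrite sumr_const card_ord.
Qed.

(** This is the increment in the induction of [mean_length_le_half]. *)
Lemma geom_sum_step_ge0 n r : 0 <= r <= 1 ->
  2 * n.+3%:R * r ^+ n.+2 <= geom_sum n.+3 r + n.+3%:R * r ^+ n.+3.
Proof.
move=> /andP[r0 r1]; elim: n => [|n IH].
  rewrite !geom_sumS geom_sum0 -subr_ge0.
  have -> : 0 + r ^+ 0 + r ^+ 1 + r ^+ 2 + 3 * r ^+ 3 - 2 * 3 * r ^+ 2
    = (1 - r) ^+ 2 * (1 + 3 * r) :> R by ring.
  by rewrite mulr_ge0 ?sqr_ge0//; lra.
(* After multiplication by [r], the induction hypothesis differs from the goal by
   [2 r^(n+3) <= 1 + r^(n+4)], which is [le1]. It holds because [r (2 - r) = 1 - (1 - r)^2 <= 1]. *)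
have {}IH := ler_wpM2l r0 IH.
have gE k : r * geom_sum k r = geom_sum k.+1 r - 1.
  by rewrite /geom_sum big_ord_recl expr0 mulr_sumr; under eq_bigr do rewrite -exprS; ring.
have le1 : r ^+ n.+2 * (2 - r) * r <= 1.
  have := exprn_ge0 n.+2 r0; have := exprn_ile1 n.+2 r0 r1.
  move: (r ^+ n.+2) => t t1 t0; have := mulr_ge0 t0 (sqr_ge0 (1 - r)); nra.
have e3 : r ^+ n.+3 = r * r ^+ n.+2 by rewrite exprS.
have e4 : r ^+ n.+4 = r * (r * r ^+ n.+2) by rewrite exprS e3.
move: IH; rewrite [leRHS]mulrDr gE => IH; move: IH le1; rewrite !geom_sumS.
rewrite e4 e3 -(natr1 n.+3).
move: (r ^+ n.+2) (n.+3%:R) (geom_sum n r + r ^+ n + r ^+ n.+1) => t k g.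
lra.
Qed.

(** Both sides agree at [r = 1]. The induction has to start at four terms: with three, the
    difference of the sides is [(1 - r) (1 - 3 r^2)], which changes sign. *)
Lemma mean_length_le_half n r : 0 <= r <= 1 ->
  2 * arith_geom_sum n.+4 r <= n.+4%:R * geom_sum n.+1.+4 r.
Proof.
move=> r01; have /andP[r0 r1] := r01; elim: n => [|n IH].
  rewrite !geom_sumS !arith_geom_sumS geom_sum0 arith_geom_sum0 -subr_ge0.
  set x := (X in 0 <= X).
  have -> : x = 2 * ((1 - r) * ((1 - r) * (1 + 2 * r + 2 * r ^+ 2))).
    by rewrite /x; ring.
  by rewrite !mulr_ge0 ?subr_ge0//; nra.
have := geom_sum_step_ge0 n.+2 r r01.
rewrite (geom_sumS n.+1.+4) (arith_geom_sumS n.+4) -(natr1 n.+4) mulrDl mul1r.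
move: IH.
move: (geom_sum _ _) (arith_geom_sum _ _) (n.+4%:R) (r ^+ n.+4) (r ^+ n.+1.+4).
by move=> g a k t t'; lra.
Qed.

End GeometricSums.

(** * The single-server queue *)

Section SingleServer.
Local Open Scope classical_set_scope.
Local Open Scope ring_scope.
Context {R : realType} (M : pricing_model R).
Hypothesis single : servers M = 1%N.
Implicit Types (pi : policy R) (n : nat) (l : R).

Local Notation mu := (service_rate M).
Local Notation c := (holding_cost M).

Lemma weight0 pi : weight M pi 0 = 1.
Proof. by rewrite /weight big_ord0. Qed.

Lemma weightS pi n : weight M pi n.+1 = weight M pi n * (pi n / mu).
Proof.
have min1 : minn n.+1 (servers M) = 1%N by rewrite single minnSS minn0.
by rewrite /weight big_ord_recr /= min1 mulr1.
Qed.

Lemma weight_ge0 pi : (forall i, 0 <= pi i) -> forall n, 0 <= weight M pi n.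
Proof.
move=> pi0; elim=> [|n IH]; first by rewrite weight0.
by rewrite weightS mulr_ge0// divr_ge0// ltW// service_rate_gt0.
Qed.

Lemma total_weightE pi : (forall i, 0 <= pi i) ->
  total_weight M pi = (\sum_(0 <= n <oo) (weight M pi n)%:E)%E.
Proof.
move=> pi0; have w0 n : (0 <= (weight M pi n)%:E)%E by rewrite lee_fin weight_ge0.
rewrite nneseries_recl// weight0 /total_weight; congr (_ + _)%E.
by rewrite -(nneseries_addn (f := fun n => (weight M pi n)%:E) 1)//;
  apply: eq_eseriesr => n _; rewrite addn1.
Qed.

Section Stable.
Variable pi : policy R.
Hypotheses (pi_ge0 : forall i, 0 <= pi i) (pi_stable : stable M pi).

Local Notation P := (stationary_prob M pi).
Local Notation W := (fine (total_weight M pi)).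

Lemma total_weight_fin_num : total_weight M pi \is a fin_num.
Proof.
rewrite ge0_fin_numE//; apply: adde_ge0 => //.
by apply: nneseries_ge0 => n _ _; rewrite lee_fin weight_ge0.
Qed.

Lemma series_weight_cvg : series (weight M pi) n @[n --> \oo] --> W.
Proof.
have w0 := weight_ge0 _ pi_ge0.
have cw : cvgn (series (weight M pi)).
  by apply: nnseries_is_cvg => //; rewrite -total_weightE.
suff -> : W = limn (series (weight M pi)) by [].
apply: EFin_inj; rewrite -EFin_lim// fineK ?total_weight_fin_num// total_weightE//.
by congr (limn _); apply/funext => n /=; rewrite /series /= sumEFin.
Qed.

Lemma total_weight_ge1 : 1 <= W.
Proof.
have w0 := weight_ge0 _ pi_ge0.
rewrite -lee_fin fineK ?total_weight_fin_num//.
by rewrite /total_weight leeDl// nneseries_ge0// => n _ _; rewrite lee_fin.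
Qed.

Let W_gt0 : 0 < W. Proof. exact: lt_le_trans total_weight_ge1. Qed.

Lemma stationary_prob_ge0 n : 0 <= P n.
Proof. by rewrite divr_ge0 ?weight_ge0// ltW. Qed.

Lemma stationary_prob0_gt0 : 0 < P 0%N.
Proof. by rewrite /stationary_prob weight0 divr_gt0. Qed.

Lemma balance n : pi n * P n = mu * P n.+1.
Proof.
by rewrite /stationary_prob weightS; field; rewrite !gt_eqF ?service_rate_gt0.
Qed.

Lemma series_prob_cvg : series P n @[n --> \oo] --> (1 : R).
Proof.
rewrite -(divff (lt0r_neq0 W_gt0)).
under eq_fun => n do rewrite /series /= -mulr_suml.
by apply: cvgMr_tmp; exact: series_weight_cvg.
Qed.

Lemma series_prob_le1 k : series P k <= 1.
Proof.
rewrite -(cvg_lim _ series_prob_cvg)//; apply: nondecreasing_cvgn_le.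
  by apply: nondecreasing_series => i _ _; exact: stationary_prob_ge0.
by apply/cvg_ex; exists 1; exact: series_prob_cvg.
Qed.

(** Since the probabilities sum to 1, the mean of an eventually constant function is that constant
    plus a finite correction. *)
Lemma series_shift_cvg (u : nat -> R) (d : R) k :
  (forall i, (k <= i)%N -> u i = d) ->
  series (fun i => u i * P i) n @[n --> \oo]
    --> d + \sum_(i < k) (u i - d) * P i.
Proof.
move=> ud; rewrite -[X in X + _]mulr1.
have h n : (k <= n)%N -> series (fun i => u i * P i) n =
    d * series P n + \sum_(i < k) (u i - d) * P i.
  move=> kn; rewrite /series /= mulr_sumr -(big_mkord xpredT (fun i => (u i - d) * P i)).
  rewrite (big_cat_nat _ (n := k))//= [X in _ = X + _](big_cat_nat _ (n := k))//=.
  rewrite addrAC -big_split /=; congr (_ + _); apply: eq_big_nat => i; last first.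
    by move=> /andP[ki _]; rewrite ud.
  by move=> _; ring.
have lim : d * series P n + \sum_(i < k) (u i - d) * P i @[n --> \oo]
    --> d * 1 + \sum_(i < k) (u i - d) * P i.
  by apply: cvgD; [apply: cvgMl_tmp; exact: series_prob_cvg | exact: cvg_cst].
apply: cvg_trans lim; apply: near_eq_cvg; exists k => // n /= kn; by rewrite h.
Qed.

(** By balance, the partial sums of the flow are [mu] times those of the probabilities from state 1
    on. *)
Lemma series_flow_cvg :
  series (fun i => pi i * P i) n @[n --> \oo] --> mu * (1 - P 0%N).
Proof.
have -> : series (fun i => pi i * P i) = fun n => mu * (series P n.+1 - P 0%N).
  apply/funext => n; rewrite /series /= (big_nat_recl n 0)// addrC addrA addNr add0r.
  by rewrite mulr_sumr; apply: eq_bigr => i _; rewrite balance.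
apply: cvgMl_tmp; apply: cvgB; last exact: cvg_cst.
by rewrite (cvg_shiftS (series P)); exact: series_prob_cvg.
Qed.

Lemma average_rateE : average_rate M pi = mu * (1 - P 0%N).
Proof. by apply: cvg_lim => //; exact: series_flow_cvg. Qed.

(** Meant for the truncations [min(i, 1)] and [min(i, 2)] of the queue length: their means depend on
    finitely many probabilities, and the true mean may be infinite. *)
Lemma congestion_cost_ge (u : nat -> R) l :
  (forall i, 0 <= u i <= i%:R) ->
  series (fun i => u i * P i) n @[n --> \oo] --> l ->
  ((c * l)%:E <= congestion_cost M pi)%E.
Proof.
move=> ui ul; rewrite /congestion_cost asboolT// EFinM.
rewrite lee_pmul2l ?lte_fin ?holding_cost_gt0//.
have -> : l%:E = (\sum_(0 <= i <oo) (u i * P i)%:E)%E.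
  have cu : cvgn (series (fun i => u i * P i)) by apply/cvg_ex; exists l.
  rewrite -(cvg_lim _ ul)// -EFin_lim//.
  by congr (limn _); apply/funext => n /=; rewrite /series /= sumEFin.
apply: lee_nneseries => i _ => [_|].
  by rewrite lee_fin mulr_ge0 ?stationary_prob_ge0//; case/andP: (ui i).
by rewrite lee_fin ler_wpM2r ?stationary_prob_ge0//; case/andP: (ui i).
Qed.

End Stable.

Lemma congestion_cost_ge0 pi : (forall i, 0 <= pi i) ->
  (0 <= congestion_cost M pi)%E.
Proof.
move=> pi0; rewrite /congestion_cost; case: asboolP => // st.
rewrite mule_ge0 ?lee_fin ?(ltW (holding_cost_gt0 M))//.
by apply: nneseries_ge0 => n _ _; rewrite lee_fin mulr_ge0 ?stationary_prob_ge0.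
Qed.

Lemma congestion_cost_unstable pi : ~ stable M pi -> congestion_cost M pi = +oo%E.
Proof. by move=> st; rewrite /congestion_cost asboolF. Qed.

Lemma utilization_cost pi : (forall i, 0 <= pi i) -> stable M pi ->
  ((c * (1 - stationary_prob M pi 0))%:E <= congestion_cost M pi)%E.
Proof.
move=> pi0 st; apply: (congestion_cost_ge _ pi0 st (fun i => (0 < i)%N%:R)).
  by case=> [|i] /=; rewrite ?lexx ?ler01// ler1n.
have := series_shift_cvg _ pi0 st (fun i => (0 < i)%N%:R) 1 1.
rewrite big_ord1 /= sub0r mulN1r; apply.
by case.
Qed.

End SingleServer.

(** * Finitely supported series and comparison of series *)

Section FiniteSeries.
Local Open Scope classical_set_scope.
Local Open Scope ring_scope.
Context {R : realType}.
Implicit Types (u : nat -> R) (k : nat).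

Lemma series_finite_cvg u k : (forall i, (k <= i)%N -> u i = 0) ->
  series u n @[n --> \oo] --> \sum_(i < k) u i.
Proof.
have lim : (\sum_(i < k) u i) @[_ --> \oo] --> \sum_(i < k) u i by exact: cvg_cst.
move=> u0; apply: cvg_trans lim; apply: near_eq_cvg.
exists k => // n /= kn; rewrite /series /= -(big_mkord xpredT u).
have tail : \sum_(k <= i < n) u i = 0.
  by rewrite big_nat_cond big1// => i /andP[/andP[/u0]].
by rewrite [RHS](big_cat_nat _ (n := k))//= tail addr0.
Qed.

Lemma nneseries_finite u k : (forall i, (k <= i)%N -> u i = 0) ->
  (\sum_(0 <= n <oo) (u n)%:E)%E = (\sum_(i < k) u i)%:E.
Proof.
move=> /series_finite_cvg uk.
have cu : cvgn (series u) by apply/cvg_ex; eexists; exact: uk.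
rewrite -(cvg_lim _ uk)// -EFin_lim//.
by congr (limn _); apply/funext => n /=; rewrite /series /= sumEFin.
Qed.

(** Revenue terms have no fixed sign, but [u - a] is nonnegative and dominated by [b - a]. *)
Lemma series_squeeze_cvg (a u b : nat -> R) :
  cvgn (series a) -> cvgn (series b) ->
  (forall i, a i <= u i) -> (forall i, u i <= b i) -> cvgn (series u).
Proof.
move=> ca cb au ub.
have cba : cvgn (series (b - a)) by apply: is_cvg_seriesB.
have cua : cvgn (series (u - a)).
  apply: (@series_le_cvg _ _ (b - a)) => // i; rewrite !fctE ?subr_ge0//.
    by rewrite (le_trans (au i)).
  by rewrite lerD2r.
rewrite -[u](subrK a); exact: is_cvg_seriesD.
Qed.

Lemma nonneg_series_cvg0 u : (forall i, 0 <= u i) ->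
  series u n @[n --> \oo] --> (0 : R) -> forall i, u i = 0.
Proof.
move=> u0 cu i; apply/eqP; rewrite eq_le u0 andbT -(cvg_lim _ cu)//.
apply: limr_ge; first by apply/cvg_ex; exists 0.
exists i.+1 => // n /= lin; rewrite /series /= (big_cat_nat _ (n := i.+1))//=.
rewrite big_nat_recr//= -addrA addrCA lerDl addr_ge0// sumr_ge0//.
Qed.

End FiniteSeries.

(** * Concave functions and supporting lines *)

Lemma concave_chord {R : realType} (f : R -> R) (L t x y : R) :
  @convex_function R R^o `[0, L]%classic (fun l : R => - f l) ->
  0 <= t <= 1 -> 0 <= x <= L -> 0 <= y <= L ->
  t * f x + (1 - t) * f y <= f (t * x + (1 - t) * y).
Proof.
move=> cf /andP[t0 t1] xL yL; have := cf (Itv01 t0 t1) x y.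
rewrite !inE /= !in_itv /= => /(_ xL yL) h.
have {}h : - f (t * x + (1 - t) * y) <= t * - f x + (1 - t) * - f y := h.
lra.
Qed.

(** The slope is the supremum of the chord slopes to the right of [m]; by concavity, each of them is
    at most every chord slope to the left. An interior [m] has chords on both sides. *)
Lemma concave_supporting_line {R : realType} (f : R -> R) (L m : R) :
  @convex_function R R^o `[0, L]%classic (fun l : R => - f l) ->
  0 < m < L -> exists s, forall x, 0 <= x <= L -> f x <= f m + s * (x - m).
Proof.
move=> cf /andP[m0 mL].
have chord x y : 0 <= x -> x < m -> m < y -> y <= L ->
    (f y - f m) / (y - m) <= (f m - f x) / (m - x).
  move=> x0 xm my yL.
  have yx : 0 < y - x by lra.
  have t01 : 0 <= (y - m) / (y - x) <= 1.
    by rewrite divr_ge0 ?ler_pdivrMr//; lra.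
  have xL : 0 <= x <= L by lra.
  have yL0 : 0 <= y <= L by lra.
  have := concave_chord _ _ _ _ _ cf t01 xL yL0.
  have -> : (y - m) / (y - x) * x + (1 - (y - m) / (y - x)) * y = m.
    by field; rewrite gt_eqF.
  move=> h; rewrite ler_pdivrMr ?subr_gt0// mulrAC ler_pdivlMr ?subr_gt0//.
  move: h; rewrite -(ler_pM2r yx).
  have -> : ((y - m) / (y - x) * f x + (1 - (y - m) / (y - x)) * f y) *
    (y - x) = (y - m) * f x + (m - x) * f y by field; rewrite gt_eqF.
  by move=> h; nra.
pose A := [set (f y - f m) / (y - m) | y in `]m, L]]%classic.
have Aub : has_ubound A.
  exists ((f m - f 0) / (m - 0)) => _ [y /= + <-]; rewrite in_itv /= => /andP[my yL].
  exact: chord.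
exists (sup A) => x /andP[x0 xL]; rewrite -lerBlDl.
have [xm|mx|<-] := ltgtP x m; last by rewrite !subrr mulr0.
  rewrite -lerN2 -mulrN !opprB -ler_pdivlMr ?subr_gt0//.
  apply: ge_sup; first by exists ((f L - f m) / (L - m)), L => //=; rewrite in_itv /= mL lexx.
  by move=> _ [y /= + <-]; rewrite in_itv /= => /andP[my yL]; exact: chord.
rewrite -ler_pdivrMr ?subr_gt0//; apply: ub_le_sup => //.
by exists x => //=; rewrite in_itv /= mx.
Qed.

(** * Jensen's bound on the revenue *)

Section Policies.
Local Open Scope classical_set_scope.
Local Open Scope ring_scope.
Context {R : realType} (M : pricing_model R).
Hypothesis single : servers M = 1%N.
Implicit Types (pi : policy R) (n : nat) (l : R).

Local Notation mu := (service_rate M).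
Local Notation c := (holding_cost M).

(** Jensen's inequality: the supporting line of [l p(l)] at the mean rate [m] dominates the revenue
    in each state, and its own mean is its value at [m]. *)
Lemma revenue_le_average pi : admissible M pi -> stable M pi ->
  revenue M pi <= average_rate M pi * price M (average_rate M pi).
Proof.
move=> adm st; set m := average_rate M pi.
have pi0 i : 0 <= pi i by case/andP: (adm i).
have piL i : pi i <= market_rate M by case/andP: (adm i).
have L0 := market_rate_gt0 M; set L := market_rate M in piL L0.
have P0 i := stationary_prob_ge0 M single pi pi0 st i.
pose P := stationary_prob M pi; pose f l := l * price M l.
have cP : series P n @[n --> \oo] --> (1 : R) by exact: series_prob_cvg.
have cflow : series (fun i => pi i * P i) n @[n --> \oo] --> m.
  rewrite /m average_rateE//; exact: series_flow_cvg.
(* A line through the point [(m, a)] has mean [a], whatever its slope. *)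
have cline a s : series (fun i => (a + s * (pi i - m)) * P i) n @[n --> \oo] --> a.
  have -> : series (fun i => (a + s * (pi i - m)) * P i) =
      fun n => (a - s * m) * series P n + s * series (fun i => pi i * P i) n.
    apply/funext => n; rewrite /series /= !mulr_sumr -big_split /=.
    by apply: eq_bigr => i _; ring.
  rewrite [X in _ --> X](_ : a = (a - s * m) * 1 + s * m); last by ring.
  by apply: cvgD; apply: cvgMl_tmp.
have m0 : 0 <= m.
  rewrite -(cvg_lim _ cflow)//; apply: limr_ge; first by apply/cvg_ex; exists m.
  by apply: nearW => n; apply: sumr_ge0 => i _; rewrite mulr_ge0// P0.
have mL : m <= L.
  rewrite -(cvg_lim _ cflow)//.
  have cL : series (fun i => (L + 0 * (pi i - m)) * P i) n @[n --> \oo] --> L by exact: cline.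
  rewrite -(cvg_lim _ cL)//; apply: lim_series_le.
  - by apply/cvg_ex; exists m.
  - by apply/cvg_ex; exists L.
  - by move=> i; rewrite mul0r addr0 ler_wpM2r// P0.
(* At an end of [[0, L]] there may be no supporting line, for instance if the slope at 0 is
   infinite. But then every state of positive probability uses the rate [m] itself, and slope 0
   works. *)
have [s fs] : exists s, forall i, f (pi i) * P i <= (f m + s * (pi i - m)) * P i.
  have [m_gt0|] := ltP 0 m; last first.
    move=> m_le0; exists 0 => i; rewrite mul0r addr0.
    have m_0 : m = 0 by apply/le_anti; rewrite m_le0 m0.
    move: (cflow); rewrite m_0 => /nonneg_series_cvg0 => /(_ _ i) h.
    have /eqP := h (fun i => mulr_ge0 (pi0 i) (P0 i)).
    by rewrite mulf_eq0 => /orP[/eqP -> //|/eqP ->]; rewrite !mulr0.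
  have [m_ltL|m_geL] := ltP m L.
    have [||s fs] := concave_supporting_line f L m; first exact: revenue_concave.
      by rewrite m_gt0.
    by exists s => i; rewrite ler_wpM2r ?P0// fs// pi0 piL.
  exists 0 => i; rewrite mul0r addr0.
  have m_L : m = L by apply/le_anti; rewrite m_geL mL.
  have := nonneg_series_cvg0 (fun i => (0 + - 1 * (pi i - m)) * P i).
  move=> /(_ _ (cline 0 (- 1)) i) h.
  have /eqP := h (fun i => ltac:(by rewrite add0r mulN1r opprB mulr_ge0 ?P0// subr_ge0 m_L)).
  rewrite mulf_eq0 add0r mulN1r oppr_eq0 subr_eq0.
  by move=> /orP[/eqP -> //|/eqP ->]; rewrite !mulr0.
(* The lower bound makes the revenue series converge, so that [limn] is its true sum. It is the
   chord from [f 0 = 0] to [f L]. *)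
have flow i : - `|f L| <= f (pi i).
  have t01 : 0 <= pi i / L <= 1 by rewrite ler_pdivrMr// mul1r piL divr_ge0// ltW.
  have LL : 0 <= L <= L by rewrite lexx andbT ltW.
  have z0L : 0 <= (0 : R) <= L by rewrite lexx ltW.
  have := concave_chord f _ _ _ _ (@revenue_concave _ M) t01 LL z0L.
  have -> : f 0 = 0 by rewrite /f mul0r.
  rewrite !mulr0 !addr0 divfK ?gt_eqF//; apply: le_trans.
  case/andP: t01 => t0 t1; rewrite lerNl -mulrN.
  apply: le_trans (ler_wpM2l t0 (ler_norm _)) _.
  by rewrite normrN ler_piMl.
rewrite /revenue -[leRHS](cvg_lim _ (cline (f m) s))//; apply: lim_series_le => //.
  apply: (series_squeeze_cvg (fun i => (- `|f L| + 0 * (pi i - m)) * P i) _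
    (fun i => (f m + s * (pi i - m)) * P i)) => // [||i].
  - by apply/cvg_ex; exists (- `|f L|); exact: cline.
  - by apply/cvg_ex; exists (f m); exact: cline.
  - by rewrite mul0r addr0; exact: (ler_wpM2r (P0 i) (flow i)).
by apply/cvg_ex; exists (f m); exact: cline.
Qed.

(** * The truncated queue of a static policy *)

Section Static.
Variables (l : R) (gamma : nat).
Hypothesis l0 : 0 <= l.
Let r := l / mu.
Let static := static_policy l gamma.

Let r0 : 0 <= r. Proof. by rewrite divr_ge0// ltW// service_rate_gt0. Qed.

Lemma static_ge0 i : 0 <= static i.
Proof. by rewrite /static /static_policy; case: ifP. Qed.

(** The rate [l] still applies in state [gamma], so the queue can reach [gamma + 1], which gives
    [gamma + 2] states. *)
Lemma static_weight i :
  weight M static i = if (i < gamma.+2)%N then r ^+ i else 0.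
Proof.
elim: i => [|i IH]; first by rewrite weight0.
rewrite weightS// IH /static /static_policy !ltnS.
have [ig|gi] := leqP i gamma; first by rewrite leqW// exprSr.
by rewrite mul0r mulr0.
Qed.

Lemma static_total_weight : total_weight M static = (geom_sum gamma.+2 r)%:E.
Proof.
rewrite total_weightE//; last exact: static_ge0.
rewrite (nneseries_finite _ gamma.+2).
  by congr (_%:E); apply: eq_bigr => i _; rewrite static_weight ltn_ord.
by move=> i gi; rewrite static_weight ltnNge gi.
Qed.

Lemma static_stable : stable M static.
Proof. by rewrite /stable static_total_weight ltry. Qed.

Lemma static_prob i : stationary_prob M static i =
  (if (i < gamma.+2)%N then r ^+ i else 0) / geom_sum gamma.+2 r.
Proof. by rewrite /stationary_prob static_weight static_total_weight. Qed.

(** The quotient is the probability that an arrival is not blocked. In blocked states the rate 0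
    removes the revenue whatever the price assigned to it. *)
Lemma static_revenue :
  revenue M static = l * price M l * (geom_sum gamma.+1 r / geom_sum gamma.+2 r).
Proof.
have H i : (gamma.+1 <= i)%N ->
    static i * price M (static i) * stationary_prob M static i = 0.
  by move=> gi; rewrite /static /static_policy leqNgt gi /= !mul0r.
rewrite /revenue (cvg_lim _ (series_finite_cvg _ _ H))//.
rewrite /geom_sum !mulr_suml mulr_sumr; apply: eq_bigr => i _.
by rewrite static_prob /static /static_policy -ltnS ltn_ord leqW.
Qed.

(** The factor [r] is pulled out to cancel against the lower bound [c r] on the optimal cost. *)
Lemma static_cost : congestion_cost M static =
  (c * (r * arith_geom_sum gamma.+1 r / geom_sum gamma.+2 r))%:E.
Proof.
rewrite /congestion_cost asboolT; last exact: static_stable.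
rewrite (nneseries_finite _ gamma.+2); last first.
  by move=> i gi; rewrite static_prob ltnNge gi /= mul0r mulr0.
rewrite -EFinM -sum_index_geom mulr_suml; congr (_ * _)%:E.
by apply: eq_bigr => i _; rewrite static_prob ltn_ord mulrA.
Qed.

End Static.

End Policies.

(** * The uniform instance *)

Section UniformModel.
Local Open Scope classical_set_scope.
Local Open Scope ring_scope.
Context {R : realType} {Lam b : R}.
Hypotheses (Lam_gt0 : 0 < Lam) (b_gt0 : 0 < b).

Lemma uniform_support_lt : 1 < 1 + b. Proof. by rewrite ltrDl. Qed.

Let nu : probability (measurableTypeR R) R := uniform_prob uniform_support_lt.
Let I : interval R := `[1, 1 + b].

Lemma uniform_cdf x : x \in I -> valuation_cdf nu x = (x - 1) / b.
Proof.
rewrite in_itv /= => /andP[x1 xb].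
rewrite /valuation_cdf /nu /= /uniform_prob integral_uniform_pdf.
have -> : `]-oo, x] `&` `[1, 1 + b] = `[1, x]%classic :> set R.
  apply/seteqP; split => y /=; rewrite !in_itv /=; first by move=> [-> /andP[-> _]].
  by move=> /andP[-> yx]; rewrite yx (le_trans yx xb).
rewrite (eq_integral (fun=> b^-1%:E)).
  rewrite integral_cst//= lebesgue_measure_itv/= lte_fin.
  have [x1'|] := ltP 1 x; first by rewrite -EFinD /= mulrC.
  move=> x1'; have -> : x = 1 by apply/le_anti; rewrite x1 x1'.
  by rewrite mule0 subrr mul0r.
move=> y; rewrite inE /= in_itv /= => /andP[y1 yx].
by rewrite /uniform_pdf y1 (le_trans yx xb) /= addrAC subrr add0r.
Qed.

Lemma uniform_regular : regular nu I.
Proof.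
exists (uniform_pdf 1 (1 + b)); have lt1 := uniform_support_lt; split.
- exact: measurable_uniform_pdf.
- by move=> x; exact: uniform_pdf_ge0.
- by [].
- move=> x; rewrite /uniform_pdf in_itv /=; case: ifP => _; last by rewrite ltxx.
  by rewrite invr_gt0 subr_gt0 lt1.
- have vE x : x \in I -> virtual_value nu (uniform_pdf 1 (1 + b)) x = 2 * x - (1 + b).
    move=> xI; rewrite /virtual_value uniform_cdf//.
    move: xI; rewrite in_itv /= /uniform_pdf => ->.
    by field; rewrite gt_eqF// subr_gt0.
  by move=> x y xI yI xy; rewrite !vE// lerD2r ler_pM2l.
Qed.

Lemma uniform_arrival_rate x : x \in I ->
  arrival_rate Lam nu x = Lam * (1 - (x - 1) / b).
Proof. by move=> xI; rewrite /arrival_rate uniform_cdf. Qed.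

(** The solution [x] of [Lam (1 - (x - 1) / b) = l]: it falls from [1 + b] at rate 0 to 1 at rate
    [Lam]. *)
Definition uniform_price (l : R) : R := 1 + b * (1 - l / Lam).

Lemma uniform_arrival_rateK x : admissible_prices Lam nu I x ->
  uniform_price (arrival_rate Lam nu x) = x.
Proof.
move=> [xI _]; rewrite uniform_arrival_rate// /uniform_price.
by field; rewrite !gt_eqF.
Qed.

Lemma uniform_arrival_rate_bij :
  set_bij (admissible_prices Lam nu I) `]0, Lam] (arrival_rate Lam nu).
Proof.
split.
- move=> x [xI x0] /=; rewrite in_itv /= x0 /= uniform_arrival_rate//.
  move: xI; rewrite in_itv /= => /andP[x1 _].
  by rewrite ler_piMr ?(ltW Lam_gt0)// gerBl divr_ge0 ?subr_ge0// ltW.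
- move=> x y; rewrite !inE => xA yA e.
  by rewrite -(uniform_arrival_rateK _ xA) -(uniform_arrival_rateK _ yA) e.
- move=> l /=; rewrite in_itv /= => /andP[l0 lL].
  have lL0 : 0 <= l / Lam by rewrite divr_ge0 ?ltW.
  have lL1 : l / Lam <= 1 by rewrite ler_pdivrMr// mul1r.
  have pI : uniform_price l \in I.
    rewrite in_itv /= /uniform_price lerDl lerD2l mulr_ge0 ?(ltW b_gt0)/= ?subr_ge0//.
    by rewrite ler_piMr ?(ltW b_gt0)// gerBl.
  have aE : arrival_rate Lam nu (uniform_price l) = l.
    by rewrite uniform_arrival_rate// /uniform_price; field; rewrite !gt_eqF.
  by exists (uniform_price l) => //; split => //; rewrite aE.
Qed.

Lemma uniform_revenue_concave :
  @convex_function R R^o `[0, Lam]%classic (fun l : R => - (l * uniform_price l)).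
Proof.
move=> t x y _ _.
suff : - ((t%:num * x + (1 - t%:num) * y) * uniform_price (t%:num * x + (1 - t%:num) * y))
  <= t%:num * - (x * uniform_price x) + (1 - t%:num) * - (y * uniform_price y) by [].
rewrite -subr_ge0 /uniform_price; set d := (X in 0 <= X).
(* The revenue is quadratic in the rate with leading coefficient [- b / Lam], so its concavity gap
   is explicit. *)
have -> : d = b / Lam * (t%:num * (1 - t%:num) * (x - y) ^+ 2).
  by rewrite /d; field; rewrite gt_eqF.
have bLam : 0 <= b / Lam by rewrite divr_ge0// ltW.
apply: (mulr_ge0 bLam); apply: mulr_ge0 (sqr_ge0 _); exact: mulr_ge0.
Qed.

Definition uniform_model : pricing_model R := @PricingModel R 1 Lam 1 (3 / 4)
  nu I uniform_price isT Lam_gt0 ltr01 ltac:(lra) uniform_regular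
  uniform_arrival_rate_bij uniform_arrival_rateK uniform_revenue_concave.

End UniformModel.

(** * Optimality of admitting one customer at a time *)

Section ThresholdPolicy.
Local Open Scope classical_set_scope.
Local Open Scope ring_scope.
Context {R : realType} {Lam b : R}.
Hypotheses (Lam_gt0 : 0 < Lam) (b_gt0 : 0 < b) (b_small : b * (1 + Lam) <= 1 / 4).

Let M := uniform_model Lam_gt0 b_gt0.

Lemma threshold_revenue : revenue M (static_policy Lam 0) = Lam / (1 + Lam).
Proof.
rewrite static_revenue ?ltW// !geom_sumS geom_sum0 /= divr1 /uniform_price divff ?gt_eqF//.
by rewrite expr0 expr1 subrr mulr0 add0r addr0 mulr1 mul1r.
Qed.

Lemma threshold_cost :
  congestion_cost M (static_policy Lam 0) = (3 / 4 * (Lam / (1 + Lam)))%:E.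
Proof.
rewrite static_cost ?ltW// !geom_sumS geom_sum0 arith_geom_sumS arith_geom_sum0 /= divr1.
by rewrite expr0 expr1 !add0r !mulr1.
Qed.

Lemma threshold_average_rate : average_rate M (static_policy Lam 0) = Lam / (1 + Lam).
Proof.
have l0 := ltW Lam_gt0.
rewrite average_rateE//; [|exact: static_ge0|exact: static_stable].
rewrite static_prob//= !geom_sumS geom_sum0 divr1 expr0 expr1 add0r mul1r div1r.
by field; rewrite gt_eqF// ltr_wpDr.
Qed.

Lemma objective_le_threshold pi : admissible M pi -> stable M pi ->
  (objective M pi <= (Lam / (1 + Lam) / 4)%:E)%E.
Proof.
move=> adm st; pose P := stationary_prob M pi.
have pi0 i : 0 <= pi i by case/andP: (adm i).
have piL i : pi i <= Lam by case/andP: (adm i).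
have sM : servers M = 1%N by [].
have P0 i : 0 <= P i := stationary_prob_ge0 M sM pi pi0 st i.
have P01 : P 0%N + P 1%N <= 1.
  have := series_prob_le1 M sM pi pi0 st 2.
  by rewrite /series /= big_nat_recr//= big_nat1.
have bal i : pi i * P i = P i.+1 by rewrite (balance M sM)// mul1r.
have pr0 i : 0 <= 1 - pi i / Lam <= 1.
  by rewrite subr_ge0 ler_pdivrMr// mul1r piL gerBl divr_ge0// ltW.
have price0 i : 0 <= uniform_price (Lam := Lam) (b := b) (pi i) <= 1 + b.
  have /andP[q0 q1] := pr0 i; have := mulr_ge0 (ltW b_gt0) q0.
  by have := ler_wpM2l (ltW b_gt0) q1; rewrite /uniform_price; lra.
pose p0 := uniform_price (Lam := Lam) (b := b) (pi 0%N).
(* Here the queue length is replaced by [min(i, 2)]. *)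
have cost_lb : ((3 / 4 * (2 - 2 * P 0%N - P 1%N))%:E <= congestion_cost M pi)%E.
  apply: (congestion_cost_ge M sM pi pi0 st (fun i => (minn i 2)%:R)).
    by move=> i; rewrite ler0n ler_nat geq_minl.
  have := series_shift_cvg M sM pi pi0 st (fun i => (minn i 2)%:R) 2 2.
  rewrite -(big_mkord xpredT (fun i => ((minn i 2)%:R - 2) * P i)).
  rewrite big_nat_recr//= big_nat1 min0n (minn_idPl _)//.
  rewrite (_ : 2 + ((0 - 2) * _ + _) = 2 - 2 * P 0%N - P 1%N); last by ring.
  by apply=> i /minn_idPr ->.
(* Every price is raised to [1 + b], except in state 0, where the correction restores [p0]; the flow
   out of state 0 is [P 1] by balance. *)
pose v i := (1 + b) * (pi i * P i) +
  (if i is 0 then (p0 - (1 + b)) * P 1%N else 0).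
have vlim : series v n @[n --> \oo] -->
    (1 + b) * (1 - P 0%N) + (p0 - (1 + b)) * P 1%N.
  have -> : series v = fun n => (1 + b) * series (fun i => pi i * P i) n +
      series (fun i : nat => if i is 0 then (p0 - (1 + b)) * P 1%N else 0) n.
    by apply/funext => n; rewrite /series /= mulr_sumr -big_split.
  apply: cvgD.
    apply: cvgMl_tmp; have := series_flow_cvg M sM pi pi0 st; by rewrite mul1r.
  have := @series_finite_cvg R
    (fun i : nat => if i is 0 then (p0 - (1 + b)) * P 1%N else 0) 1.
  by rewrite big_ord1; apply; case.
have rev_ub : revenue M pi <= (1 + b) * (1 - P 0%N) + (p0 - (1 + b)) * P 1%N.
  have uv i : pi i * uniform_price (Lam := Lam) (b := b) (pi i) * P i <= v i.
    rewrite /v mulrAC bal mulrC; have /andP[_ q] := price0 i.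
    case: i q => [|i] q; first by rewrite /p0 -bal; lra.
    by rewrite addr0 ler_wpM2r.
  have u0 i : 0 <= pi i * uniform_price (Lam := Lam) (b := b) (pi i) * P i.
    by apply: mulr_ge0 (P0 i); apply: mulr_ge0 (pi0 i) _; case/andP: (price0 i).
  have cv : cvgn (series v) by apply/cvg_ex; eexists; exact: vlim.
  rewrite -(cvg_lim _ vlim)//; apply: lim_series_le => //.
  apply: series_le_cvg cv => // i; exact: le_trans (u0 i) (uv i).
rewrite /objective; apply: le_trans (leeB (lexx _) cost_lb) _.
rewrite -EFinB lee_fin; apply: le_trans (lerB rev_ub (lexx _)) _.
have b4 : b <= 1 / 4.
  by apply: le_trans b_small; rewrite ler_peMr ?(ltW b_gt0)// lerDl ltW.
have -> : (1 + b) * (1 - P 0%N) + (p0 - (1 + b)) * P 1%N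
    - 3 / 4 * (2 - 2 * P 0%N - P 1%N) =
  (p0 - 3 / 4) * P 1%N + (b - 1 / 2) * (1 - P 0%N - P 1%N) by field.
have tail : (b - 1 / 2) * (1 - P 0%N - P 1%N) <= 0.
  by rewrite mulr_le0_ge0//; lra.
suff : (p0 - 3 / 4) * P 1%N <= Lam / (1 + Lam) / 4 by lra.
have L1 : 0 < 1 + Lam by rewrite addr_gt0.
have l1 : 0 < 1 + pi 0%N by rewrite ltr_pwDl.
have /andP[q0 q1] := pr0 0%N.
(* From [P 1 = pi 0 * P 0] and [P 0 + P 1 <= 1]. *)
have p1 : P 1%N <= pi 0%N / (1 + pi 0%N).
  rewrite ler_pdivlMr//; move: P01 (pi0 0%N); rewrite -bal => P01 l0.
  by have := ler_wpM2l l0 P01; lra.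
have p34 : 0 <= p0 - 3 / 4.
  by rewrite /p0 /uniform_price; have := mulr_ge0 (ltW b_gt0) q0; lra.
apply: le_trans (ler_wpM2l p34 p1) _.
(* This is the remaining inequality in [pi 0] with denominators cleared. *)
have gap : b * (1 + Lam) * (pi 0%N / Lam) * (Lam - pi 0%N) <= (Lam - pi 0%N) / 4.
  rewrite [leRHS]mulrC ler_wpM2r ?subr_ge0//.
  apply: le_trans (_ : b * (1 + Lam) <= _); last by rewrite -div1r.
  by rewrite ler_piMr ?mulr_ge0 ?(ltW b_gt0) ?(ltW L1)// -subr_ge0.
rewrite mulrA ler_pdivrMr//.
have -> : Lam / (1 + Lam) / 4 * (1 + pi 0%N) = Lam * (1 + pi 0%N) / 4 / (1 + Lam).
  by field; rewrite gt_eqF.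
rewrite ler_pdivlMr//; move: gap; rewrite /p0 /uniform_price.
have -> : pi 0%N = pi 0%N / Lam * Lam by rewrite divfK ?gt_eqF.
rewrite mulfK ?gt_eqF//; move: (pi 0%N / Lam) => t; lra.
Qed.

Lemma threshold_optimal : optimal M (static_policy Lam 0).
Proof.
split=> [i|pi adm].
  by rewrite /static_policy; case: ifP => _ /=; rewrite lexx ltW.
have -> : objective M (static_policy Lam 0) = (Lam / (1 + Lam) / 4)%:E.
  rewrite /objective threshold_revenue threshold_cost -EFinB; congr _%:E.
  by field; rewrite gt_eqF// addr_gt0.
have [st|st] := pselect (stable M pi); first exact: objective_le_threshold.
by rewrite /objective congestion_cost_unstable// addeNy leNye.
Qed.

End ThresholdPolicy.

(** The choice [Lam = r / (1 - r)] solves [Lam / (1 + Lam) = r], so every load in [(0, 1)] occurs;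
    [b_small] becomes [b / (1 - r) <= 1 / 4]. *)
Lemma threshold_instance (R : realType) (r b : R) : 0 < r < 1 ->
  0 < b <= (1 - r) / 4 ->
  exists (M : pricing_model R) (pi : policy R),
    [/\ servers M = 1%N, optimal M pi, service_rate M = 1, holding_cost M = 3 / 4 &
     [/\ average_rate M pi = r, revenue M pi = r,
         congestion_cost M pi = (3 / 4 * r)%:E & price M r <= 1 + b]].
Proof.
move=> /andP[r0 r1] /andP[b0 br].
have r1' : 0 < 1 - r by rewrite subr_gt0.
have L0 : 0 < r / (1 - r) by rewrite divr_gt0.
have rE : r / (1 - r) / (1 + r / (1 - r)) = r.
  by field; rewrite gt_eqF//= gt_eqF//; lra.
have bL : b * (1 + r / (1 - r)) <= 1 / 4.
  have -> : b * (1 + r / (1 - r)) = b / (1 - r) by field; rewrite gt_eqF.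
  by rewrite ler_pdivrMr//; lra.
exists (uniform_model L0 b0), (static_policy (r / (1 - r)) 0).
split=> //; first exact: threshold_optimal.
rewrite threshold_average_rate threshold_revenue threshold_cost rE; split=> //.
rewrite /= /uniform_price lerD2l ler_piMr ?(ltW b0)// gerBl.
by rewrite divr_ge0 ?(ltW L0)// ltW.
Qed.

(** * The best cost factor *)

(** Mean length of the queue truncated at [gamma + 1], divided by the load [r], which is a lower
    bound on the mean length under the optimal policy. *)
Definition queue_ratio {R : realFieldType} (gamma : nat) (r : R) : R :=
  arith_geom_sum gamma.+1 r / geom_sum gamma.+2 r.

Lemma queue_ratio_ge0 {R : realFieldType} gamma (r : R) :
  0 <= r -> 0 <= queue_ratio gamma r.
Proof. by move=> r0; rewrite divr_ge0 ?arith_geom_sum_ge0 ?geom_sum_ge0. Qed.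

Section CostFactor.
Local Open Scope classical_set_scope.
Local Open Scope ring_scope.
Context {R : realType}.
Implicit Types (r K : R) (gamma : nat).

Lemma queue_ratio_le r gamma : 0 < r < 1 -> queue_ratio gamma r <= cost_factor R gamma.
Proof.
move=> /andP[r0 r1]; have r01 : 0 <= r <= 1 by rewrite !ltW.
rewrite ler_pdivrMr ?geom_sum_gt0 ?(ltW r0)//.
case: gamma => [|[|[|gamma]]] /=.
- rewrite !geom_sumS geom_sum0 arith_geom_sumS arith_geom_sum0 expr0 expr1; lra.
- rewrite !geom_sumS geom_sum0 !arith_geom_sumS arith_geom_sum0 expr0 expr1.
  have s3 : Num.sqrt 3 ^+ 2 = 3 :> R by rewrite sqr_sqrtr.
  have s0 : 0 < Num.sqrt 3 :> R by rewrite sqrtr_gt0.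
  rewrite [leRHS]mulrAC ler_pdivlMr//; move: (Num.sqrt 3) s3 s0 => s s3 s0.
  (* The square vanishes at the maximizer [r = (sqrt 3 - 1) / 2]. *)
  by have := sqr_ge0 (2 * r + 1 - s); rewrite !expr2 in s3 *; lra.
- rewrite !geom_sumS geom_sum0 !arith_geom_sumS arith_geom_sum0 expr0 expr1.
  (* The double root 771/1000 approximates the maximizer of the ratio. *)
  have : 0 <= (r - 771 / 1000) ^+ 2 * (1532 / 1000 * r + 894 / 1000).
    by apply: mulr_ge0; [exact: sqr_ge0 | lra].
  by have := sqr_ge0 r; lra.
- by have := mean_length_le_half gamma r r01; lra.
Qed.

(** Some bounds are approached only as the load tends to 1, a value that stability excludes; a
    strict inequality at 1 persists slightly to its left. *)
Lemma exists_left_of_one (f : R -> R) : {for 1, continuous f} -> 0 < f 1 ->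
  exists r, 0 < r < 1 /\ 0 < f r.
Proof.
move=> cf f1; have /cvgr_gt/(_ _ f1) fgt := cvg_at_left_filter cf.
have : \forall r \near (1 : R)^'-, 0 < r < 1 /\ 0 < f r.
  near=> r; split; last by near: r; exact: fgt.
  by apply/andP; split; near: r; [exact: nbhs_left_gt | exact: nbhs_left_lt].
by move/filter_ex => [r hr]; exists r.
Unshelve. all: by end_near. Qed.

Lemma continuous_geom_sum n : continuous (geom_sum n : R -> R).
Proof.
apply: continuous_big => [|i _]; first exact: add_continuous.
exact: exprn_continuous.
Qed.

Lemma continuous_arith_geom_sum n : continuous (arith_geom_sum n : R -> R).
Proof.
apply: continuous_big => [|i _ x]; first exact: add_continuous.
by apply: cvgMl_tmp; exact: exprn_continuous.
Qed.

(** The supremum is approached as [r] tends to 0 for [gamma = 0], and as [r] tends to 1 for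
    [gamma >= 3]. *)
Definition best_cost_factor gamma : R := sup (queue_ratio gamma @` `]0, 1[).

Lemma has_sup_queue_ratio gamma : has_sup (queue_ratio gamma @` `]0, (1 : R)[).
Proof.
split.
  by exists (queue_ratio gamma (1 / 2)), (1 / 2) => //=; rewrite in_itv /=; lra.
exists (cost_factor R gamma) => _ [r /= + <-]; rewrite in_itv /=.
exact: queue_ratio_le.
Qed.

Lemma best_cost_factor_ub gamma r : 0 < r < 1 -> queue_ratio gamma r <= best_cost_factor gamma.
Proof.
move=> r01; apply: ub_le_sup; first by case: (has_sup_queue_ratio gamma).
by exists r => //=; rewrite in_itv.
Qed.

Lemma best_cost_factor_ge0 gamma : 0 <= best_cost_factor gamma.
Proof.
by apply: le_trans (best_cost_factor_ub gamma (1 / 2) _);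
  [apply: queue_ratio_ge0 | ]; lra.
Qed.

Lemma best_cost_factor_le gamma : best_cost_factor gamma <= cost_factor R gamma.
Proof.
apply: ge_sup; first by case: (has_sup_queue_ratio gamma).
by move=> _ [r /= + <-]; rewrite in_itv /=; exact: queue_ratio_le.
Qed.

Lemma best_cost_factor0 : 1 <= best_cost_factor 0.
Proof.
rewrite leNgt; apply/negP; set K := best_cost_factor 0 => K1.
have K0 : 0 <= K := best_cost_factor_ge0 0.
(* At this load the bound [1 / (1 + r) <= K] reads [(1 - K) (2 - K) <= 0], which fails for
   [K < 1]. *)
have := best_cost_factor_ub 0 ((1 - K) / 2); rewrite -/K => /(_ ltac:(lra)).
rewrite /queue_ratio !geom_sumS geom_sum0 arith_geom_sumS arith_geom_sum0 expr0 expr1.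
rewrite ler_pdivrMr; last by lra.
nra.
Qed.

Lemma best_cost_factor1 : 2 / Num.sqrt 3 <= best_cost_factor 1.
Proof.
have s3 : Num.sqrt 3 ^+ 2 = 3 :> R by rewrite sqr_sqrtr.
have s0 : 0 < Num.sqrt 3 :> R by rewrite sqrtr_gt0.
have s13 : 1 < (Num.sqrt 3 : R) < 3.
  by move: (Num.sqrt 3) s3 s0 => s s3 s0; apply/andP; split; nra.
(* The maximizer is the positive root of [2 r^2 + 2 r = 1]. *)
have := best_cost_factor_ub 1 ((Num.sqrt 3 - 1) / 2) ltac:(lra).
apply: le_trans; rewrite /queue_ratio.
rewrite !geom_sumS geom_sum0 !arith_geom_sumS arith_geom_sum0 expr0 expr1.
move: (Num.sqrt 3) s3 s0 s13 => s s3 s0 s13.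
have -> : 0 + 1 + (s - 1) / 2 + ((s - 1) / 2) ^+ 2 = 3 / 2.
  by have -> : 0 + 1 + (s - 1) / 2 + ((s - 1) / 2) ^+ 2 = (3 + s ^+ 2) / 4;
    [field | rewrite s3; field].
rewrite ler_pdivrMr// [leRHS]mulrAC ler_pdivlMr//; rewrite expr2 in s3; lra.
Qed.

(** The left side is 1.532 less the rounding error 5/10000; the load 771/1000 is close to the
    maximizer. *)
Lemma best_cost_factor2 : 3063 / 2000 <= best_cost_factor 2.
Proof.
have := best_cost_factor_ub 2 (771 / 1000) ltac:(lra); apply: le_trans.
rewrite /queue_ratio !geom_sumS geom_sum0 !arith_geom_sumS arith_geom_sum0 !exprS expr0.
by rewrite ler_pdivlMr; lra.
Qed.

(** The left side is the value of the ratio at [r = 1], reached by continuity from below. *)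
Lemma best_cost_factor_half gamma : gamma.+1%:R / 2 <= best_cost_factor gamma.
Proof.
rewrite leNgt; apply/negP; set K := best_cost_factor gamma => Klt.
pose h r := arith_geom_sum gamma.+1 r - K * geom_sum gamma.+2 r.
have ch : {for 1, continuous h}.
  apply: cvgB; first exact: continuous_arith_geom_sum.
  by apply: cvgMl_tmp; exact: continuous_geom_sum.
have [|r [r01 hr]] := exists_left_of_one h ch.
  rewrite /h arith_geom_sum_at1 geom_sum_at1 natrM mulrAC -mulrBl.
  by rewrite mulr_gt0 ?ltr0n// subr_gt0.
have := best_cost_factor_ub gamma r r01; rewrite leNgt => /negP; apply.
case/andP: r01 => r0 _.
by rewrite ltr_pdivlMr ?geom_sum_gt0 ?ltW// -subr_gt0.
Qed.

Lemma best_cost_factorE gamma : gamma != 2%N ->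
  best_cost_factor gamma = cost_factor R gamma.
Proof.
move=> g2; apply/le_anti; rewrite best_cost_factor_le /=.
move: g2; case: gamma => [|[|[|gamma]]] //= _; first exact: best_cost_factor0.
  exact: best_cost_factor1.
exact: best_cost_factor_half.
Qed.

Lemma best_cost_factor_approx gamma :
  `|best_cost_factor gamma - cost_factor R gamma|
    <= (if gamma == 2%N then 5 / 10000 else 0).
Proof.
have [->|g2] := eqVneq gamma 2%N; last by rewrite best_cost_factorE// subrr normr0.
have := best_cost_factor2; have := best_cost_factor_le 2; rewrite /= => u l.
by rewrite ler_norml; lra.
Qed.

End CostFactor.

(** * Guarantees of the static policy *)

Section OptimalPolicy.
Context {R : realType} (M : pricing_model R) (pistar : policy R) (gamma : nat).
Hypotheses (single : servers M = 1%N) (opt : optimal M pistar).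

Local Notation avg := (average_rate M pistar).
Local Notation static := (static_policy avg gamma).
Local Notation r := (avg / service_rate M).

Lemma optimal_ge0 i : 0 <= pistar i.
Proof. by case: opt => adm _; case/andP: (adm i). Qed.

(** Comparison with the policy that admits nobody, which earns and costs nothing. *)
Lemma objective_optimal_ge0 : (0 <= objective M pistar)%E.
Proof.
case: opt => _ /(_ (static_policy 0 0)).
rewrite {1}/objective static_revenue// static_cost// mul0r mul0r.
rewrite mul0r mul0r mul0r mulr0 sube0; apply=> i.
by rewrite /static_policy if_same lexx ltW// market_rate_gt0.
Qed.

Lemma optimal_stable : stable M pistar.
Proof.
apply: contrapT => ns; have := objective_optimal_ge0.
by rewrite /objective congestion_cost_unstable// addeNy.
Qed.

(** Prices may be negative, so the sign comes from optimality: the revenue covers a nonnegative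
    cost. *)
Lemma optimal_revenue_ge0 : 0 <= revenue M pistar.
Proof.
have := objective_optimal_ge0; rewrite /objective.
have := congestion_cost_ge0 M single pistar optimal_ge0.
case: congestion_cost => [x| |]//; rewrite lee_fin => x0.
by rewrite -EFinB lee_fin subr_ge0; exact: le_trans.
Qed.

Lemma utilizationE : r = 1 - stationary_prob M pistar 0.
Proof.
rewrite average_rateE//; [|exact: optimal_ge0|exact: optimal_stable].
by rewrite mulrAC divff ?mul1r// gt_eqF// service_rate_gt0.
Qed.

Lemma utilization_itv : 0 <= r < 1.
Proof.
have st := optimal_stable; have p0 := optimal_ge0.
rewrite utilizationE subr_ge0 gtrBl (stationary_prob0_gt0 M single)//.
by have := series_prob_le1 M single _ p0 st 1; rewrite /series /= big_nat1 andbT.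
Qed.

Lemma average_rate_ge0 : 0 <= avg.
Proof.
case/andP: utilization_itv => + _.
by rewrite pmulr_lge0// invr_gt0 service_rate_gt0.
Qed.

Lemma static_revenue_ge :
  gamma.+1%:R / gamma.+2%:R * revenue M pistar <= revenue M static.
Proof.
have a0 := average_rate_ge0; have /andP[r0 r1] := utilization_itv.
rewrite static_revenue// mulrC.
apply: ler_pM; rewrite ?divr_ge0 ?optimal_revenue_ge0//.
  by apply: revenue_le_average => //; [case: opt | exact: optimal_stable].
rewrite ler_pdivrMr ?ltr0n// mulrAC ler_pdivlMr ?geom_sum_gt0// [leRHS]mulrC.
by apply: acceptance_ratio; rewrite r0 ltW.
Qed.

(** A general [K] serves both the stated factor and the supremum. At load 0 the static policy costs
    nothing. *)
Lemma static_cost_le (K : R) : 0 <= K ->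
  (forall x : R, 0 < x < 1 -> queue_ratio gamma x <= K) ->
  (congestion_cost M static <= K%:E * congestion_cost M pistar)%E.
Proof.
move=> K0 hK; have a0 := average_rate_ge0; have /andP[r0 r1] := utilization_itv.
have p0 := optimal_ge0.
rewrite static_cost//; have [r_gt0|] := ltP 0 r; last first.
  move=> r_le0; have -> : r = 0 by apply/le_anti; rewrite r_le0 r0.
  by rewrite !mul0r mulr0 mule_ge0// congestion_cost_ge0.
apply: (@le_trans _ _ (K%:E * (holding_cost M * r)%:E)%E); last first.
  rewrite lee_wpmul2l ?lee_fin// utilizationE.
  exact: utilization_cost optimal_stable.
rewrite -EFinM lee_fin [leRHS]mulrC -[X in _ * X <= _]mulrA [leLHS]mulrA.
apply: (ler_wpM2l (mulr_ge0 (ltW (holding_cost_gt0 M)) r0)).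
by apply: hK; rewrite r_gt0.
Qed.

End OptimalPolicy.

(** * Tightness of both factors *)

Lemma static_revenue_tight (R : realType) (gamma : nat) (K : R) :
  gamma.+1%:R / gamma.+2%:R < K ->
  exists (M : pricing_model R) (pistar : policy R),
    [/\ servers M = 1%N, optimal M pistar &
        revenue M (static_policy (average_rate M pistar) gamma)
          < K * revenue M pistar].
Proof.
rewrite ltr_pdivrMr ?ltr0n// => hK.
pose h r : R := K * geom_sum gamma.+2 r - geom_sum gamma.+1 r.
have ch : {for 1, continuous h}.
  by apply: cvgB; [apply: cvgMl_tmp|]; exact: continuous_geom_sum.
have [|r [/andP[r0 r1] hr]] := exists_left_of_one h ch.
  by rewrite /h !geom_sum_at1 subr_gt0.
have S0 : 0 < geom_sum gamma.+1 r by rewrite geom_sum_gt0 ?ltW.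
have D0 : 0 < geom_sum gamma.+2 r by rewrite geom_sum_gt0 ?ltW.
(* The first bound is required by [threshold_instance]. The second lets the price increase to
   [1 + b] use up only half of the slack [h r]. *)
pose b := Num.min ((1 - r) / 4) (h r / (2 * geom_sum gamma.+1 r)).
have b0 : 0 < b.
  rewrite lt_min; apply/andP; split; first by rewrite divr_gt0// subr_gt0.
  by rewrite divr_gt0// mulr_gt0.
have br : 0 < b <= (1 - r) / 4 by rewrite b0 ge_min lexx.
have bh : b * geom_sum gamma.+1 r <= h r / 2.
  rewrite -ler_pdivlMr// -mulrA -invfM ge_min lexx orbT//.
have r01 : 0 < r < 1 by rewrite r0.
have [M [pi [sM opt mu1 _ [av rev _ pr]]]] := threshold_instance R r b r01 br.
exists M, pi; split=> //; rewrite av rev static_revenue ?ltW// mu1 divr1.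
rewrite [K * r]mulrC -mulrA ltr_pM2l// mulrA ltr_pdivrMr//.
apply: le_lt_trans (_ : (1 + b) * geom_sum gamma.+1 r < _).
  by rewrite ler_wpM2r// ltW.
by move: bh hr; rewrite /h; lra.
Qed.

(** In the threshold instance the optimal cost is exactly [c r], so the cost ratio is
    [queue_ratio gamma r]; [r] is chosen to bring it above [K]. *)
Lemma static_cost_tight (R : realType) (gamma : nat) (K : R) :
  K < best_cost_factor gamma ->
  exists (M : pricing_model R) (pistar : policy R),
    [/\ servers M = 1%N, optimal M pistar &
        (K%:E * congestion_cost M pistar
           < congestion_cost M (static_policy (average_rate M pistar) gamma))%E].
Proof.
case/(sup_gt (has_sup_queue_ratio gamma).1) => _ [r /= + <-] Kr.
rewrite in_itv /= => r01; have /andP[r0 r1] := r01.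
have br : 0 < (1 - r) / 4 <= (1 - r) / 4 by rewrite lexx divr_gt0// subr_gt0.
have [M [pi [sM opt mu1 c1 [av _ cost _]]]] := threshold_instance R r _ r01 br.
exists M, pi; split=> //; rewrite av cost static_cost ?ltW// mu1 divr1 c1.
rewrite -EFinM lte_fin [ltLHS]mulrC -[X in _ < _ * X]mulrA [ltRHS]mulrA.
by rewrite ltr_pM2l// mulr_gt0// divr_gt0.
Qed.

(** Cost tightness goes through the exact best factor [K], because 1.532 is a rounded value; for
    every other [gamma], [K] is the stated factor. *)
Theorem theorem2 (R : realType) (gamma : nat) :
  (forall (M : pricing_model R) (pistar : policy R),
     servers M = 1%N -> optimal M pistar ->
     let static := static_policy (average_rate M pistar) gamma in
     gamma.+1%:R / gamma.+2%:R * revenue M pistar <= revenue M static /\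
     (congestion_cost M static
        <= (cost_factor R gamma)%:E * congestion_cost M pistar)%E) /\
  (forall K : R, gamma.+1%:R / gamma.+2%:R < K ->
     exists (M : pricing_model R) (pistar : policy R),
       [/\ servers M = 1%N, optimal M pistar &
           revenue M (static_policy (average_rate M pistar) gamma)
             < K * revenue M pistar]) /\
  (exists K : R,
     [/\ `|K - cost_factor R gamma|
           <= (if gamma == 2%N then 5 / 10000 else 0),
         forall (M : pricing_model R) (pistar : policy R),
           servers M = 1%N -> optimal M pistar ->
           (congestion_cost M (static_policy (average_rate M pistar) gamma)
              <= K%:E * congestion_cost M pistar)%E &
         forall K' : R, K' < K ->
           exists (M : pricing_model R) (pistar : policy R),
             [/\ servers M = 1%N, optimal M pistar &
                 (K'%:E * congestion_cost M pistar
                    < congestion_cost M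
                        (static_policy (average_rate M pistar) gamma))%E]]).
Proof.
split; last split.
- move=> M pistar single opt static; split; first exact: static_revenue_ge.
  apply: static_cost_le => //; last by move=> x; exact: queue_ratio_le.
  exact: le_trans (best_cost_factor_ge0 gamma) (best_cost_factor_le gamma).
- exact: static_revenue_tight.
- exists (best_cost_factor gamma); split.
  + exact: best_cost_factor_approx.
  + move=> M pistar single opt; apply: static_cost_le => //.
      exact: best_cost_factor_ge0.
    by move=> x; exact: best_cost_factor_ub.
  + exact: static_cost_tight.
Qed.
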